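(* Let $q\in\mathbb{Z}_+^{\mathcal I}$ be a state in the trivial boundary, and let $s\in\mathcal P$ be any schedule such that $q_{\rho}=0$ for every $\rho\in\mathcal I$ with $s_{\rho}=0$. Then choosing $s$ is optimal at $q$ in every value iteration; that is, for every $n\ge 0$, $s$ attains the maximum $$\max_{s'\in\mathcal P}\left\{ r(q,s')+\beta\,\mathbb{E}\big[V_n((q-s')^++A)\big]\right\}.$$
   Context: Let $\mathcal I=\{(i,j): i,j\in\{1,2\}\}$ index the four queues of a $2\times 2$ input-queued switch (queue $(i,j)$ is for input port $i$ and output port $j$). States are vectors $q=(q_\rho)_{\rho\in\mathcal I}\in\mathbb{Z}_+^{\mathcal I}\cong\mathbb{Z}_+^4$, $\mathbb{Z}_+=\{0,1,2,\dots\}$. A schedule is a vector $s=(s_\rho)_{\rho\in\mathcal I}\in\{0,1\}^{\mathcal I}$ with $\sum_j s_{(i,j)}\le 1$ for each $i$ and $\sum_i s_{(i,j)}\le 1$ for each $j$; $\mathcal P$ is the set of all schedules. The arrival vector $A=(A_\rho)_{\rho\in\mathcal I}$ takes values in $\mathbb{Z}_+^{\mathcal I}$, has independent coordinates, and its means $\lambda_\rho=\mathbb{E}[A_\rho]$ satisfy $\sum_i\lambda_{(i,j)}<1$ for each $j$ and $\sum_j\lambda_{(i,j)}<1$ for each $i$. Fix cost constants $c_\rho\ge 0$ ($\rho\in\mathcal I$) and $\beta\in(0,1)$. The reward is $r(q,s)=\sum_{\rho\in\mathcal I}c_\rho s_\rho\,\mathbb{I}_{\{q_\rho>0\}}$.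 Write $(x)^+$ for the componentwise maximum of $x$ and $0$. The value functions of value iteration are $V_0\equiv 0$ and $V_{n+1}(q)=\max_{s\in\mathcal P}\{r(q,s)+\beta\,\mathbb{E}[V_n((q-s)^++A)]\}$ for $n\ge 0$. A state $q\in\mathbb{Z}_+^{\mathcal I}$ is in the trivial boundary if there exists $s\in\mathcal P$ such that $q_\rho=0$ whenever $s_\rho=0$ (i.e. $s$ can serve packets in all nonempty queues of $q$). *)

(* Defs.v *)
From HB Require Import structures.
From mathcomp Require Import all_boot all_order all_algebra.
From mathcomp Require Import all_classical all_reals all_analysis.

Set Implicit Arguments.
Unset Strict Implicit.
Unset Printing Implicit Defensive.

Import Order.TTheory GRing.Theory Num.Theory.

Local Open Scope classical_set_scope.
Local Open Scope ring_scope.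
Local Open Scope ereal_scope.

Definition mutually_independent d d' (T : measurableType d)
    (T' : measurableType d') (R : realType) (P : probability T R)
    (I : finType) (X : I -> {RV P >-> T'}) : Prop :=
  forall (J : {set I}) (B : I -> set T'), (forall i, measurable (B i)) ->
    P (\bigcap_(i in [set` J]) (X i @^-1` B i)) =
    \prod_(i in J) P (X i @^-1` B i).

(* (i, j) is the queue from input port i to output port j; ports are numbered
   from 0. *)
Definition queue : finType := ('I_2 * 'I_2)%type.

Notation state := {ffun queue -> nat}.
Notation schedule := {ffun queue -> bool}.

Definition schedules : {set schedule} :=
  [set s : schedule |
     [forall i : 'I_2, (\sum_(j < 2) s (i, j) <= 1)%N] &&
     [forall j : 'I_2, (\sum_(i < 2) s (i, j) <= 1)%N]]%SET.

(* s serves every nonempty queue of q. *)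
Definition covers (s : schedule) (q : state) : Prop :=
  forall rho, s rho = false -> q rho = 0%N.

Definition trivial_boundary (q : state) : Prop :=
  exists2 s : schedule, s \in schedules & covers s q.

Section value_iteration.
Context d (T : measurableType d) (R : realType) (P : probability T R).
Variables (A : queue -> {RV P >-> nat}) (c : queue -> R) (beta : R).

Definition arrival_rate (rho : queue) : \bar R :=
  'E_P[fun w => (A rho w)%:R].

Definition reward (q : state) (s : schedule) : R :=
  (\sum_rho c rho * (s rho)%:R * (0 < q rho)%N%:R)%R.

(* Truncated subtraction on nat is the positive part in (q - s)^+ + A. *)
Definition next_state (q : state) (s : schedule) (w : T) : state :=
  [ffun rho => (q rho - s rho + A rho w)%N].

(* Extended-real only because expectations are; its values are finite for
   every V occurring in value iteration (see objective_bounds, bellman). *)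
Definition objective (V : state -> R) (q : state) (s : schedule) : \bar R :=
  (reward q s)%:E + beta%:E * 'E_P[fun w => V (next_state q s w)].

(* fine discards nothing here: see bellman. *)
Fixpoint value (n : nat) (q : state) : R :=
  if n is m.+1 then
    fine (\big[maxe/-oo]_(s in schedules) objective (value m) q s)
  else 0%R.

Hypotheses (c_ge0 : forall rho, (0 <= c rho)%R) (beta_ge0 : (0 <= beta)%R).

Lemma measurable_next (V : state -> R) q s :
  measurable_fun setT (fun w => V (next_state q s w)).
Proof.
move=> _ Y mY; rewrite setTI.
pose F (x : state) := if x \in V @^-1` Y then
  \bigcap_(rho in [set: queue])
    ((fun w => (q rho - s rho + A rho w)%N) @^-1` [set x rho]) else set0.
have -> : (fun w => V (next_state q s w)) @^-1` Y = \bigcup_x F x.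
  apply/seteqP; split=> [w Yw|w [x _]].
    exists (next_state q s w) => //; rewrite /F mem_set// => rho _ /=.
    by rewrite ffunE.
  rewrite /F; case: ifPn => // /set_mem Yx xE /=.
  suff -> : next_state q s w = x by [].
  by apply/ffunP => rho; rewrite ffunE; exact: xE.
apply: countable_bigcupT_measurable; first exact: countableP.
move=> x; rewrite /F; case: ifPn => // _.
apply: fin_bigcap_measurable; first exact: finite_finset.
move=> rho _.
have : measurable_fun setT (A rho) by exact: measurable_funPT.
move=> /(_ measurableT [set k | (q rho - s rho + k)%N = x rho] I).
by rewrite setTI.
Qed.

Lemma objective_bounds (V : state -> R) M :
    (forall q, 0 <= V q <= M)%R ->
  exists K : R, forall q s, 0 <= objective V q s <= K%:E.
Proof.
move=> VM; exists (\sum_rho c rho + beta * M)%R => q s.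
have rew : (0 <= reward q s <= \sum_rho c rho)%R.
  apply/andP; split; first by apply: sumr_ge0 => rho _; rewrite !mulr_ge0.
  apply: ler_sum => rho _; rewrite -mulrA ler_piMr//.
  by case: (s rho); case: (0 < q rho)%N; rewrite ?mulr1 ?mulr0.
have E0 : 0 <= 'E_P[fun w => V (next_state q s w)].
  by apply: expectation_ge0 => w; case/andP: (VM (next_state q s w)).
have EM : 'E_P[fun w => V (next_state q s w)] <= M%:E.
  rewrite -(expectation_cst P M); apply: expectation_le => //.
  - exact: measurable_next.
  - by move=> w; case/andP: (VM (next_state q s w)).
  - by move=> w; case/andP: (VM q) => /le_trans; apply.
  - by apply: aeW => w; case/andP: (VM (next_state q s w)).
case/andP: rew => r0 r1; rewrite /objective; apply/andP; split.
  by rewrite adde_ge0 ?lee_fin// mule_ge0.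
by rewrite EFinD EFinM; apply: leeD; rewrite ?lee_fin// lee_wpmul2l.
Qed.

Lemma schedule0_in : [ffun=> false] \in schedules.
Proof.
by rewrite inE; apply/andP; split; apply/forallP => i;
  rewrite big1// => j _; rewrite ffunE.
Qed.

Lemma max_bounds (V : state -> R) M :
    (forall q, 0 <= V q <= M)%R ->
  exists K : R, forall q,
    0 <= \big[maxe/-oo]_(s in schedules) objective V q s <= K%:E.
Proof.
move=> /objective_bounds[K VK]; exists K => q; apply/andP; split.
  case/andP: (VK q [ffun=> false]) => /le_trans + _; apply.
  exact: (le_bigmax_cond _ _ schedule0_in).
by apply/bigmax_leP; split=> [|s _]; rewrite ?leNye//; case/andP: (VK q s).
Qed.

Lemma value_bounds n : exists M : R, forall q, (0 <= value n q <= M)%R.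
Proof.
elim: n => [|n [M /max_bounds[K VK]]]; first by exists 0%R => q /=; rewrite lexx.
exists K => q /=; case/andP: (VK q) => m0 mK.
by rewrite fine_ge0//= -lee_fin fineK// ge0_fin_numE// (le_lt_trans mK) ?ltry.
Qed.

Lemma bellman n q :
  (value n.+1 q)%:E =
  \big[maxe/-oo]_(s in schedules) objective (value n) q s.
Proof.
have [M /max_bounds[K VK]] := value_bounds n.
case/andP: (VK q) => m0 mK.
by rewrite /= fineK// ge0_fin_numE// (le_lt_trans mK) ?ltry.
Qed.

End value_iteration.

(* Main.v *)
Require Import Defs.
From HB Require Import structures.
From mathcomp Require Import all_boot all_order all_algebra.
From mathcomp Require Import all_classical all_reals all_analysis.
From mathcomp Require Import measurable_realfun lra.

Set Implicit Arguments.
Unset Strict Implicit.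
Unset Printing Implicit Defensive.

Import Order.TTheory GRing.Theory Num.Theory.

Local Open Scope classical_set_scope.
Local Open Scope ring_scope.
Local Open Scope ereal_scope.

(** The theorem holds because holding a packet is never worth more than
    delivering it at once.  Weigh a state by its holding value, the total cost
    coefficient of the packets that it contains.  Serving a queue collects
    exactly the holding value which that service removes ([reward_holding]), so
    when two systems are driven by the same arrivals, the difference between
    their rewards in a step is the decrease, over that step, of the difference
    between their holding values.

    Hence a system that starts with more packets can gain at most their holding
    value over a smaller one ([value_subholding]): let the smaller system copy
    the schedules of the larger.  Any reward for the extra packets is collected
    either now, at full value, or later, discounted by beta <= 1.

    At a state covered by [s], the schedule [s] leaves no more packets in any
    queue than any other schedule does ([leftover_covers]).  A competing
    schedule keeps some extra packets, gives up their full holding value as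
    immediate reward, and by the bound above recovers at most beta times that
    amount.  Both arguments are one comparison of two state-schedule pairs,
    [objective_le_holding], used with equal schedules for the first and with
    equal states for the second. *)

Definition leftover (q : state) (s : schedule) : state :=
  [ffun rho => (q rho - s rho)%N].

Definition holding (R : realType) (c : queue -> R) (q : state) : R :=
  (\sum_rho c rho * (q rho)%:R)%R.

Definition subholding (R : realType) (c : queue -> R) (V : state -> R) : Prop :=
  forall q q' : state, (forall rho, q rho <= q' rho)%N ->
    (V q' <= V q + (holding c q' - holding c q))%R.

(** A served queue pays exactly when a packet leaves it. *)
Lemma reward_holding (R : realType) (c : queue -> R) q s :
  reward c q s = (holding c q - holding c (leftover q s))%R.
Proof.
rewrite /reward /holding -sumrB; apply: eq_bigr => rho _.
rewrite ffunE -mulrBr -mulrA; congr (_ * _)%R.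
rewrite -natrB ?leq_subr// -natrM; congr (_%:R)%R.
case: (s rho); case: (q rho) => [|k] //=.
all: by rewrite ?subn0 ?subnn ?subn1 ?subSnn.
Qed.

Lemma holding_le (R : realType) (c : queue -> R) (q q' : state) :
    (forall rho, 0 <= c rho)%R -> (forall rho, q rho <= q' rho)%N ->
  (holding c q <= holding c q')%R.
Proof.
by move=> c0 qq'; apply: ler_sum => rho _; rewrite ler_wpM2l// ler_nat.
Qed.

Lemma leftover_covers (q : state) (s s' : schedule) : covers s q ->
  forall rho, (leftover q s rho <= leftover q s' rho)%N.
Proof.
move=> sq rho; rewrite !ffunE; case E: (s rho); last by rewrite (sq _ E).
by apply: leq_sub2l; case: (s' rho).
Qed.

(** Nonnegativity makes the expectation additive here even if it is infinite. *)
Lemma expectation_le_addr d (T : measurableType d) (R : realType)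
    (P : probability T R) (X Y : T -> R) (D : R) :
    measurable_fun setT X -> measurable_fun setT Y ->
    (forall w, 0 <= X w)%R -> (forall w, 0 <= Y w)%R -> (0 <= D)%R ->
    (forall w, X w <= Y w + D)%R ->
  'E_P[X] <= 'E_P[Y] + D%:E.
Proof.
move=> mX mY X0 Y0 D0 XY.
rewrite -(expectation_cst P D) !unlock -ge0_integralD//=.
- apply: ge0_le_integral => //=.
  + by move=> w _; rewrite lee_fin.
  + exact/measurable_EFinP.
  + by apply/measurable_EFinP; exact: measurable_funD.
  + by move=> w _; rewrite lee_fin.
- by move=> w _; rewrite lee_fin.
- exact/measurable_EFinP.
Qed.

Section holding_value.
Context d (T : measurableType d) (R : realType) (P : probability T R).
Variables (A : queue -> {RV P >-> nat}) (c : queue -> R) (beta : R).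
Hypotheses (c_ge0 : forall rho, (0 <= c rho)%R).
Hypotheses (beta_ge0 : (0 <= beta)%R) (beta_le1 : (beta <= 1)%R).

Lemma holding_next q s w : holding c (next_state A q s w) =
  (holding c (leftover q s) + \sum_rho c rho * (A rho w)%:R)%R.
Proof.
by rewrite -big_split/=; apply: eq_bigr => rho _; rewrite !ffunE natrD mulrDr.
Qed.

(** Under common arrivals the two next states differ in holding value by
    D = holding (leftover q' s') - holding (leftover q s), so the second pair
    loses D in immediate reward, relative to the difference of the starting
    states, and recovers at most beta * D <= D. *)
Lemma objective_le_holding (V : state -> R) q q' s s' :
    (forall x, 0 <= V x)%R -> subholding c V ->
    (forall rho, leftover q s rho <= leftover q' s' rho)%N ->
  objective A c beta V q' s' <=
    objective A c beta V q s + (holding c q' - holding c q)%:E.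
Proof.
move=> V0 subV le_left; rewrite /objective !reward_holding.
set D := (holding c (leftover q' s') - holding c (leftover q s))%R.
have D0 : (0 <= D)%R by rewrite subr_ge0 holding_le.
have EV : 'E_P[fun w => V (next_state A q' s' w)] <=
          'E_P[fun w => V (next_state A q s w)] + D%:E.
  apply: expectation_le_addr => //; try exact: measurable_next.
  move=> w; apply: le_trans (subV (next_state A q s w) _ _) _.
    by move=> rho; move: (le_left rho); rewrite !ffunE leq_add2r.
  by rewrite lerD2l !holding_next opprD addrACA subrr addr0.
have beta_EV : beta%:E * 'E_P[fun w => V (next_state A q' s' w)] <=
    beta%:E * 'E_P[fun w => V (next_state A q s w)] + D%:E.
  apply: le_trans (lee_wpmul2l _ EV) _; first by rewrite lee_fin.
  rewrite ge0_muleDr ?lee_fin//; last exact: expectation_ge0.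
  by rewrite leeD2l// -EFinM lee_fin ler_piMl.
apply: le_trans (leeD2l _ beta_EV) _.
(* Both sides are now the same discounted expectation plus a real constant. *)
rewrite [X in X <= _]addeCA [X in _ <= X]addeAC addeC -!EFinD addeC.
by rewrite addeC leeD2r// lee_fin /D; lra.
Qed.

Lemma value_ge0 n q : (0 <= value A c beta n q)%R.
Proof. by have [M /(_ q)/andP[]] := value_bounds A c_ge0 beta_ge0 n. Qed.

(** The smaller system can imitate any schedule [s] of the larger one, since
    truncated subtraction of [s] is monotone in the state. *)
Lemma value_subholding n : subholding c (value A c beta n).
Proof.
elim: n => [|n IHn] q q' qq'; first by rewrite add0r subr_ge0 holding_le.
rewrite -lee_fin EFinD !bellman//; apply/bigmax_leP; split=> [|s s_sched].
  exact: leNye.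
apply: le_trans (objective_le_holding (q := q) (s := s) _ IHn _) _.
- exact: value_ge0.
- by move=> rho; rewrite !ffunE leq_sub2r.
- by rewrite leeD2r// (le_bigmax_cond _ _ s_sched).
Qed.

End holding_value.

Theorem theorem1 (R : realType) (d : measure_display) (T : measurableType d)
  (P : probability T R) (A : queue -> {RV P >-> nat})
  (c : queue -> R) (beta : R)
  (A_indep : mutually_independent A)
  (output_load : forall j : 'I_2, \sum_(i < 2) arrival_rate A (i, j) < 1)
  (input_load : forall i : 'I_2, \sum_(j < 2) arrival_rate A (i, j) < 1)
  (c_ge0 : forall rho : queue, (0 <= c rho)%R)
  (beta_gt0 : (0 < beta)%R) (beta_lt1 : (beta < 1)%R)
  (q : state) (q_trivial : trivial_boundary q)
  (s : schedule) (s_sched : s \in schedules) (s_covers : covers s q)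
  (n : nat) :
  objective A c beta (value A c beta n) q s =
  \big[maxe/-oo]_(s' in schedules)
    objective A c beta (value A c beta n) q s'.
Proof.
apply/le_anti/andP; split; first exact: (le_bigmax_cond _ _ s_sched).
apply/bigmax_leP; split=> [|s' _]; first exact: leNye.
have beta0 := ltW beta_gt0; have beta1 := ltW beta_lt1.
have := @objective_le_holding _ _ _ _ A c beta c_ge0 beta0 beta1
  (value A c beta n) q q s s'.
rewrite subrr adde0; apply.
- exact: value_ge0.
- exact: value_subholding.
- exact: leftover_covers.
Qed.
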